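(* For every nonnegative integer $n$, $$\sum_{j=0}^{\infty}p(n-2T_j)=\sum_{j=0}^{\infty}pod(j)\,\overline{\mathcal{E}\mathcal{O}}(n-j).$$
   Context: $p(n)$ denotes the number of (unrestricted) partitions of $n$, and $pod(n)$ the number of partitions of $n$ in which odd parts are distinct and even parts may be repeated; $p(0)=pod(0)=1$. For $j\ge0$, $T_j=\frac{j(j+1)}{2}$. $\mathcal{E}\mathcal{O}(n)$ counts the partitions of $n$ in which every even part is less than each odd part, and $\overline{\mathcal{E}\mathcal{O}}(n)$ is the number of partitions counted by $\mathcal{E}\mathcal{O}(n)$ in which only the largest even part appears an odd number of times (partitions with no even parts in which every part appears an even number of times are also counted). For example $\overline{\mathcal{E}\mathcal{O}}(8)=5$, the relevant partitions being $8$, $4+2+2$, $3+3+2$, $3+3+1+1$, $1+1+1+1+1+1+1+1$. Its generating function is $$\sum_{n\ge0}\overline{\mathcal{E}\mathcal{O}}(n)q^n=\prod_{k\ge1}\frac{(1-q^{4k})^3}{(1-q^{2k})^2}.$$ The functions $p$ and $\overline{\mathcal{E}\mathcal{O}}$ are $0$ at negative arguments. *)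

(* Defs.v *)
From HB Require Import structures.
From mathcomp Require Import all_boot all_order all_algebra.
From mathcomp Require Import boolp classical_sets functions cardinality fsbigop.

Set Implicit Arguments.
Unset Strict Implicit.
Unset Printing Implicit Defensive.

Definition is_partition (n : nat) (s : seq nat) : bool :=
  [&& sorted geq s, all (leq 1) s & sumn s == n].

(* A partition of n has at most n parts, each at most n, so letting s range
   over n.-bseq 'I_n.+1 loses no partition; see npartE. *)
Definition npart (P : pred (seq nat)) (n : nat) : nat :=
  #|[set s : n.-bseq 'I_n.+1 |
      is_partition n [seq val i | i <- s] && P [seq val i | i <- s]]|.

Definition odd_parts (s : seq nat) : seq nat := [seq i <- s | odd i].
Definition even_parts (s : seq nat) : seq nat := [seq i <- s | ~~ odd i].

Definition odd_parts_distinct (s : seq nat) : bool := uniq (odd_parts s).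

Definition evens_below_odds (s : seq nat) : bool :=
  all (fun a => all (fun b => a < b) (odd_parts s)) (even_parts s).

(* For nonempty even_parts s, the condition is an equivalence: the largest even
   part has odd multiplicity and every other part has even multiplicity. *)
Definition only_largest_even_odd (s : seq nat) : bool :=
  if nilp (even_parts s) then all (fun i => ~~ odd (count_mem i s)) s
  else all (fun i => odd (count_mem i s) ==
                     (i == \max_(a <- even_parts s) a)) s.

Definition EObar_part (s : seq nat) : bool :=
  evens_below_odds s && only_largest_even_odd s.

Definition p (z : int) : nat :=
  if z is Posz n then npart predT n else 0.

Definition pod (n : nat) : nat := npart odd_parts_distinct n.

Definition EObar (z : int) : nat :=
  if z is Posz n then npart EObar_part n else 0.

Definition T (j : nat) : nat := (j * (j + 1)) %/ 2.

Lemma is_partition_bound n s : is_partition n s ->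
  size s <= n /\ all (fun i => i < n.+1) s.
Proof.
case/and3P=> _ s_gt0 /eqP <-; elim: s s_gt0 => [|a s IHs] //= /andP[a_gt0 s_gt0].
have [sz_s all_s] := IHs s_gt0; split.
  by rewrite -add1n leq_add.
rewrite ltnS leq_addr /=; apply: sub_all all_s => i.
by rewrite !ltnS => /leq_trans; apply; rewrite leq_addl.
Qed.

Lemma npartE (P : pred (seq nat)) n (L : seq (seq nat)) : uniq L ->
  (forall s, (s \in L) = is_partition n s && P s) -> npart P n = size L.
Proof.
move=> uniqL memL; rewrite /npart.
pose f (s : n.-bseq 'I_n.+1) := [seq val i | i <- s].
have inj_f : injective f.
  by move=> s t /(inj_map val_inj) eq_st; apply: val_inj.
rewrite cardE -(size_map f); apply/perm_size/uniq_perm => //.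
  by rewrite map_inj_uniq ?enum_uniq.
move=> s; rewrite memL; apply/mapP/idP => [[t] | Ps].
  by rewrite mem_enum inE => ? ->.
have /andP[/is_partition_bound[sz_s all_s] _] := Ps.
pose u : seq 'I_n.+1 := [seq inord i | i <- s].
have sz_u : size u <= n by rewrite size_map.
have fu : f (Bseq sz_u) = s.
  rewrite /f /= -map_comp -[RHS]map_id; apply/eq_in_map => i si /=.
  by rewrite inordK //; apply: (allP all_s).
by exists (Bseq sz_u); rewrite // mem_enum inE -/(f _) fu.
Qed.

(* The finitely supported sum over [set: nat] is 0 by convention when its
   support is infinite; the next two lemmas exclude that case. *)
Lemma p_triangular_eq0 (n j : nat) : n < j ->
  p (n%:Z - (2 * T j)%:Z)%R = 0.
Proof.
move=> ltnj; suff lt : n < 2 * T j.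
  have -> : (n%:Z - (2 * T j)%:Z = Negz (2 * T j - n).-1)%R; last by [].
  by rewrite NegzE prednK ?subn_gt0 // -subzn ?(ltnW lt) // GRing.opprB.
have /dvdn_mulr H : 2 %| j * (j + 1).
  by rewrite dvdn2 oddM oddD /= addbT andbN.
apply: (leq_trans ltnj); rewrite /T mulnC divnK ?leq_pmulr ?addn1 //.
by rewrite dvdn2 oddM -addn1 oddD /= addbT andbN.
Qed.

Lemma EObar_sub_eq0 (n j : nat) : n < j -> EObar (n%:Z - j%:Z)%R = 0.
Proof.
move=> ltnj; have -> : (n%:Z - j%:Z = Negz (j - n).-1)%R; last by [].
by rewrite NegzE prednK ?subn_gt0 // -subzn ?(ltnW ltnj) // GRing.opprB.
Qed.

(* Main.v *)
(* With Q = q^2, the generating functions satisfy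
     sum EObar(n) q^n = sum_m Q^m / ((Q^2;Q^2)_m (Q^(2m+1);Q^2)_oo),
   where m is half the largest even part. Multiplying by (Q;Q^2)_oo gives
     sum_m Q^m (Q;Q^2)_m / (Q^2;Q^2)_m,
   which equals sum_j Q^(T_j) by the Rogers-Fine identity: with
     G_k = sum_m Q^((2k+1)m) (Q^(2k+1);Q^2)_m / (Q^(2k+2);Q^2)_m
   one has G_k = 1 + Q^(2k+1) + Q^(4k+3) G_(k+1), by telescoping. Moreover
     (Q;Q^2)_oo sum p(n) q^n = (-q;q^2)_oo / (q^2;q^2)_oo = sum pod(n) q^n,
   and the claim is a comparison of coefficients. Power series are replaced by
   polynomials in an element x with x^N = 0 of a commutative ring, specialized
   at the end to the class of X in Z[X]/(X^N). *)

Require Import Defs.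
From HB Require Import structures.
From mathcomp Require Import all_boot all_order all_algebra.
From mathcomp Require Import boolp classical_sets functions cardinality fsbigop.
From mathcomp Require Import ring zify.

Set Implicit Arguments.
Unset Strict Implicit.
Unset Printing Implicit Defensive.

Import GRing.Theory.
Local Open Scope ring_scope.

(** * Truncated geometric series of nilpotent elements, and the Rogers-Fine sum *)

Definition geom (A : comNzRingType) (N : nat) (a : A) : A := \sum_(j < N) a ^+ j.

Lemma geomK (A : comNzRingType) (N : nat) (a : A) :
  a ^+ N = 0 -> (1 - a) * geom N a = 1.
Proof. by move=> aN0; rewrite -opprB mulNr -subrX1 aN0 sub0r opprK. Qed.

Lemma expr_nilpotent_eq0 (A : comNzRingType) (N k : nat) (a : A) :
  a ^+ N = 0 -> (N <= k)%N -> a ^+ k = 0.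
Proof. by move=> aN0 /subnK <-; rewrite exprD aN0 mulr0. Qed.

Lemma expr_nilpotentX (A : comNzRingType) (N k : nat) (a : A) :
  a ^+ N = 0 -> (0 < k)%N -> (a ^+ k) ^+ N = 0.
Proof. by move=> aN0 k0; rewrite -exprM mulnC exprM aN0 expr0n -leqn0 leqNgt k0. Qed.

(* Fine's functional equation truncated at M terms, with its exact remainder; the
   c i stand for the inverses of 1 - x q^(2i+1). *)
Lemma rogers_fine_step (A : comNzRingType) (x q : A) (c : nat -> A) (M : nat) :
  (forall i, (1 - x * q ^+ i.*2.+1) * c i = 1) ->
  \sum_(m < M.+1) x ^+ m * \prod_(i < m) ((1 - x * q ^+ i.*2) * c i) =
  1 + x
  + x ^+ 2 * q * \sum_(m < M) (x * q ^+ 2) ^+ m *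
      \prod_(i < m) ((1 - x * q ^+ i.*2.+2) * c i.+1)
  - x ^+ M.+1 * \prod_(i < M) ((1 - x * q ^+ i.*2.+2) * c i).
Proof.
move=> cK; pose P m := \prod_(i < m) ((1 - x * q ^+ i.*2.+2) * c i).
have PS m : P m.+1 = P m * ((1 - x * q ^+ m.*2.+2) * c m).
  by rewrite /P big_ord_recr.
have P1 m : \prod_(i < m.+1) ((1 - x * q ^+ i.*2) * c i) = (1 - x) * c m * P m.
  elim: m => [|m IH]; first by rewrite big_ord1 /P big_ord0 !mulr1.
  by rewrite big_ord_recr IH PS doubleS /=; ring.
have P2 m : \prod_(i < m) ((1 - x * q ^+ i.*2.+2) * c i.+1)
            = (1 - x * q) * c m * P m.
  elim: m => [|m IH]; first by rewrite /P !big_ord0 mulr1 -[LHS](cK 0%N) expr1.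
  by rewrite big_ord_recr IH PS /=; ring.
elim: M => [|M IH].
  by rewrite big_ord1 !big_ord0; ring.
rewrite big_ord_recr IH [in RHS]big_ord_recr /= P1 P2 -/(P M) -/(P M.+1).
have PE : P M = P M * ((1 - x * q ^+ M.*2.+1) * c M) by rewrite cK mulr1.
rewrite PS [in X in _ - X + _]PE exprMn -exprM -mul2n !exprS; ring.
Qed.

Section GaussSum.
Variables (A : comNzRingType) (N : nat) (y : A).
Hypothesis yN0 : y ^+ N = 0.

(** The [G_k] of the overview with [y] for [Q]: since [y ^+ N = 0], the cut at [N] terms is exact
    and [geom N] supplies the inverses. *)
Let G k := \sum_(m < N) y ^+ k.*2.+1 ^+ m *
   \prod_(i < m) ((1 - y ^+ (k + i).*2.+1) * geom N (y ^+ (k + i).*2.+2)).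

Let G_rec k : G k = 1 + y ^+ k.*2.+1 + y ^+ (4 * k + 3) * G k.+1.
Proof.
rewrite /G; case: N yN0 => [|M] yM.
  (* If [N = 0], the hypothesis on [y] reads 1 = 0 and both sides collapse. *)
  by rewrite -[LHS]mul1r -[RHS]mul1r -(expr0 y) yM !mul0r.
have cK i : (1 - y ^+ k.*2.+1 * y ^+ i.*2.+1) * geom M.+1 (y ^+ (k + i).*2.+2) = 1.
  have -> : y ^+ k.*2.+1 * y ^+ i.*2.+1 = y ^+ (k + i).*2.+2.
    by rewrite -exprD; congr (_ ^+ _); lia.
  exact/geomK/expr_nilpotentX.
have := rogers_fine_step M cK.
have -> : y ^+ k.*2.+1 ^+ M.+1 = 0.
  by rewrite -exprM (expr_nilpotent_eq0 yM) //; lia.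
(* [G k.+1] has one term more than the sum coming from Fine's equation; multiplied by
   [y ^+ (4 * k + 3)], that term is zero. *)
rewrite mul0r subr0 [in X in _ -> _ = _ + X]big_ord_recr /= mulrDr.
rewrite [X in _ -> _ = _ + (_ + X)]mulrA.
have -> : y ^+ (4 * k + 3) * y ^+ k.+1.*2.+1 ^+ M = 0.
  by rewrite -exprM -exprD (expr_nilpotent_eq0 yM) //; nia.
rewrite mul0r addr0.
move=> H; transitivity (\sum_(m < M.+1)
   y ^+ k.*2.+1 ^+ m * \prod_(i < m)
       ((1 - y ^+ k.*2.+1 * y ^+ i.*2) * geom M.+1 (y ^+ (k + i).*2.+2))).
  apply: eq_bigr => m _; congr (_ * _); apply: eq_bigr => i _.
  by rewrite -exprD; congr ((1 - _ ^+ _) * _); lia.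
rewrite {}H; congr (_ + _ * _).
  by rewrite -exprM -exprSr; congr (_ ^+ _); lia.
apply: eq_bigr => m _; congr (_ * _).
  by rewrite -exprD; congr (_ ^+ _ ^+ _); lia.
apply: eq_bigr => i _; rewrite -exprD.
by congr ((1 - _ ^+ _) * geom _ (_ ^+ _)); lia.
Qed.

Lemma gauss_sum :
  \sum_(m < N) y ^+ m *
    \prod_(i < m) ((1 - y ^+ i.*2.+1) * geom N (y ^+ i.*2.+2)) =
  \sum_(j < N.*2) y ^+ 'C(j.+1, 2).
Proof.
(* Each use of [G_rec] adds the powers for [j = 2K] and [j = 2K + 1]; the triangular exponent in
   front of [G] grows by (2K+1) + (2K+2) = 4K+3. *)
have H K : G 0 = \sum_(j < K.*2) y ^+ 'C(j.+1, 2) + y ^+ 'C(K.*2.+1, 2) * G K.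
  elim: K => [|K ->]; first by rewrite big_ord0 add0r expr0 mul1r.
  rewrite doubleS !big_ord_recr /= G_rec -!addrA; congr (_ + _).
  rewrite !mulrDr !mulrA mulr1 -!exprD.
  by congr (y ^+ _ + (y ^+ _ + y ^+ _ * _)); rewrite !bin2; nia.
(* At [K = N] the exponent is N(2N+1) >= N, so the term in [G N] vanishes. *)
have := H N; rewrite (@expr_nilpotent_eq0 _ _ 'C(N.*2.+1, 2) _ yN0) ?mul0r ?addr0.
  move=> <-; apply: eq_bigr => m _; rewrite expr1 //.
by rewrite bin2; nia.
Qed.

End GaussSum.

(** * Partitions as multiplicity functions, and their product generating functions *)

Definition mult_pred (K : nat) (M : nat -> pred nat) (s : seq nat) : bool :=
  [forall i : 'I_K, M i.+1 (count_mem i.+1 s)].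

Definition partition_of_mults (K N : nat) (f : {ffun 'I_K -> 'I_N}) : seq nat :=
  sort geq (flatten [seq nseq (f i) i.+1 | i <- enum 'I_K]).

Section Mults.
Variables (K N : nat).
Implicit Type f : {ffun 'I_K -> 'I_N}.

Lemma count_partition_of_mults f v :
  count_mem v (partition_of_mults f) = (\sum_(i < K | i.+1 == v) f i)%N.
Proof.
rewrite /partition_of_mults count_sort count_flatten -map_comp sumnE big_map.
rewrite big_enum [RHS]big_mkcond; apply: eq_bigr => i _ /=.
by rewrite count_nseq /=; case: eqP; rewrite ?mul1n.
Qed.

Lemma count_partition_of_mults_ord f (i : 'I_K) :
  count_mem i.+1 (partition_of_mults f) = f i.
Proof.
by rewrite count_partition_of_mults (big_pred1 i) // => j; rewrite eqSS.
Qed.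

Lemma partition_of_mults_inj : injective (@partition_of_mults K N).
Proof.
move=> f g fg; apply/ffunP=> i; apply: val_inj.
by rewrite /= -!count_partition_of_mults_ord fg.
Qed.

Lemma is_partition_of_mults f n :
  is_partition n (partition_of_mults f) = (\sum_(i < K) i.+1 * f i == n)%N.
Proof.
rewrite /is_partition sort_sorted /=; last by move=> a b; apply: leq_total.
have -> : all (leq 1) (partition_of_mults f).
  apply/allP=> v; rewrite mem_sort => /flatten_mapP[i _].
  by rewrite mem_nseq => /andP[_ /eqP ->].
rewrite (perm_sumn (permEl (perm_sort _ _))) sumn_flatten -map_comp sumnE big_map.
rewrite big_enum /=; congr (_ == n); apply: eq_bigr => i _.
by rewrite sumn_nseq.
Qed.

(** A partition of [n] has at most [n] parts, all at most [n], so its multiplicities lie below [N]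
    and its parts do not exceed [K]. *)
Lemma partition_has_mults n s : (n < N)%N -> (N <= K)%N -> is_partition n s ->
  exists f, s = partition_of_mults f.
Proof.
move=> nN NK sn; have [sz_s /allP le_s] := is_partition_bound sn.
have cN (i : 'I_K) : (count_mem i.+1 s < N)%N.
  exact: leq_ltn_trans (leq_trans (count_size _ _) sz_s) nN.
exists [ffun i => Ordinal (cN i)].
have /and3P[srt /allP pos _] := sn.
apply: (@sorted_eq _ geq) => //.
- by move=> a b c ba cb; apply: leq_trans cb ba.
- by move=> a b; rewrite /= andbC => /anti_leq.
- by apply: sort_sorted => a b; apply: leq_total.
apply/allP => v _ /=; rewrite count_partition_of_mults.
under eq_bigr do rewrite ffunE /=.
case: v => [|v].
  by rewrite big_pred0 //; apply/eqP/count_memPn/negP => /pos.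
case: (ltnP v K) => vK; first by rewrite (big_pred1 (Ordinal vK)) // => j; rewrite eqSS.
rewrite big_pred0 => [|i].
  apply/eqP/count_memPn/negP => /le_s; lia.
by rewrite eqSS; apply/negbTE; rewrite neq_ltn (leq_trans (ltn_ord i) vK).
Qed.

Lemma npart_mult_pred (M : nat -> pred nat) n : (n < N)%N -> (N <= K)%N ->
  npart (mult_pred K M) n =
  #|[set f : {ffun 'I_K -> 'I_N} |
      (f \in family (fun (i : 'I_K) (j : 'I_N) => M i.+1 j))
       && (\sum_(i < K) i.+1 * f i == n)%N]|.
Proof.
move=> nN NK; set S := [set f | _].
rewrite (@npartE _ n [seq partition_of_mults f | f <- enum S]).
- by rewrite size_map -cardE.
- by rewrite (map_inj_uniq partition_of_mults_inj) enum_uniq.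
have famE f : (f \in family (fun (i : 'I_K) (j : 'I_N) => M i.+1 j)) =
              mult_pred K M (partition_of_mults f).
  apply/familyP/forallP => H i; have := H i;
    by rewrite count_partition_of_mults_ord.
move=> s; apply/mapP/andP => [[f] | [sn sM]].
  by rewrite mem_enum inE famE -is_partition_of_mults => /andP[? ?] ->.
have [f fs] := partition_has_mults nN NK sn; exists f => //.
by rewrite mem_enum inE famE -is_partition_of_mults -fs sn sM.
Qed.

(** Expanding the product chooses a multiplicity for every part size, hence a function [f] with
    monomial [x ^+ w f]. Nilpotency kills the weights from [N] on, which the left side omits. *)
Lemma partition_generating (A : comNzRingType) (x : A) (M : nat -> pred nat) :
  x ^+ N = 0 -> (N <= K)%N ->
  \sum_(n < N) (npart (mult_pred K M) n)%:R * x ^+ n =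
  \prod_(i < K) \sum_(j < N | M i.+1 j) x ^+ i.+1 ^+ j.
Proof.
move=> xN0 NK.
rewrite bigA_distr_big_dep.
pose w f := (\sum_(i < K) i.+1 * f i)%N.
transitivity (\sum_(f : {ffun 'I_K -> 'I_N} |
      f \in family (fun (i : 'I_K) (j : 'I_N) => M i.+1 j))
    \sum_(n < N | w f == n :> nat) x ^+ n).
  rewrite (exchange_big_dep predT) //=; apply: eq_bigr => n _.
  rewrite npart_mult_pred // sumr_const mulr_natl; congr (_ *+ _).
  by apply: eq_card => f; rewrite inE.
apply: eq_bigr => f _; transitivity (x ^+ w f); last first.
  by rewrite /w -prodrXr; apply: eq_bigr => i _; rewrite exprM.
case: (ltnP (w f) N) => wN.
  by rewrite (big_pred1 (Ordinal wN)) // => i; rewrite eq_sym.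
rewrite big_pred0 => [|i].
  by rewrite -(subnK wN) exprD xN0 mulr0.
by apply/negbTE; rewrite neq_ltn (leq_trans (ltn_ord i) wN) orbT.
Qed.

End Mults.

(** * From the defining conditions on partitions to conditions on multiplicities *)

Lemma npart_eq (P Q : pred (seq nat)) n :
  {in is_partition n, P =1 Q} -> npart P n = npart Q n.
Proof.
move=> PQ; apply: eq_card => s; rewrite !inE.
by case: (boolP (is_partition _ _)) => //= sn; rewrite PQ.
Qed.

(** The hypothesis says that on partitions of [n] the [Q i] exclude each other and [P] is their
    disjunction. It serves to sort partitions by their largest even part. *)
Lemma npart_sum (I : finType) (P : pred (seq nat)) (Q : I -> pred (seq nat)) n :
  {in is_partition n, forall s, P s = \sum_i Q i s :> nat}%N ->
  npart P n = (\sum_i npart (Q i) n)%N.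
Proof.
move=> PQ; pose f (s : n.-bseq 'I_n.+1) := [seq val i | i <- s].
have cE R : npart R n = (\sum_(s | is_partition n (f s)) R (f s))%N.
  rewrite -big_mkcondr /= sum1_card.
  by apply: eq_card => s; rewrite inE.
rewrite cE; under [RHS]eq_bigr do rewrite cE.
by rewrite exchange_big; apply: eq_bigr => s sn; rewrite PQ.
Qed.

Lemma mult_predP K (M : nat -> pred nat) s :
  reflect (forall v, 0 < v <= K -> M v (count_mem v s))%N (mult_pred K M s).
Proof.
apply: (iffP forallP) => [H [|v] //= vK | H i]; first exact: (H (Ordinal vK)).
by apply: H; rewrite ltn_ord.
Qed.

Lemma part_bounds n s v : is_partition n s -> v \in s -> (0 < v <= n)%N.
Proof.
move=> sn vs; have /and3P[_ /allP pos _] := sn.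
by have [_ /allP le_s] := is_partition_bound sn; rewrite pos //= -ltnS le_s.
Qed.

Lemma count_odd_parts v s :
  count_mem v (odd_parts s) = (if odd v then count_mem v s else 0)%N.
Proof.
rewrite count_filter; case ov: (odd v).
  by apply: eq_count => i /=; case: eqP => // ->; rewrite ov.
rewrite -[RHS](count_pred0 s); apply: eq_count => i /=.
by case: eqP => // ->; rewrite ov.
Qed.

Lemma odd_parts_distinct_mult n K s : (n <= K)%N -> is_partition n s ->
  odd_parts_distinct s = mult_pred K (fun v j => odd v ==> (j <= 1)%N) s.
Proof.
move=> nK sn; apply/idP/mult_predP => [us v _ | H].
  apply/implyP => ov; have := count_uniq_mem v us.
  by rewrite count_odd_parts ov => ->; apply: leq_b1.
apply: count_mem_uniq => v.
rewrite count_odd_parts mem_filter; case ov: (odd v) => //=.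
case vs: (v \in s); last by apply/count_memPn; rewrite vs.
have /andP[v0 vn] := part_bounds sn vs.
have := H v; rewrite v0 (leq_trans vn nK) ov => /(_ isT) /= c1.
by apply/eqP; rewrite eqn_leq c1 -has_count has_pred1.
Qed.

(* The conditions on the multiplicity j of v in a partition counted by EObar
   whose largest even part is 2m, with m = 0 when there is no even part. *)
Definition EObar_mult (m v j : nat) : bool :=
  if odd v then (if v < m.*2 then j == 0 else ~~ odd j)%N
  else (if v < m.*2 then ~~ odd j else if v == m.*2 then odd j else j == 0)%N.

Lemma bigmax_mem (s : seq nat) : s != [::] -> (\max_(a <- s) a)%N \in s.
Proof.
elim: s => // a [|b s] IH _; first by rewrite big_seq1 mem_head.
rewrite big_cons maxnC /maxn inE; case: ifP => _; first by rewrite eqxx.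
by rewrite IH ?orbT.
Qed.

Section EObarMult.
Variables (n N : nat) (s : seq nat).
Hypotheses (nN : (n < N)%N) (sn : is_partition n s).
(** The empty maximum is 0, which agrees with the convention [m = 0] of [EObar_mult] when there is
    no even part. *)
Let mx := (\max_(a <- even_parts s) a)%N.

Let le_mx v : v \in s -> ~~ odd v -> (v <= mx)%N.
Proof.
by move=> vs ov; apply: (@leq_bigmax_seq _ _ predT id); rewrite // mem_filter ov.
Qed.

Let mxP : (mx = 0%N /\ even_parts s = [::]) \/
  [/\ mx \in s, ~~ odd mx & even_parts s != [::]].
Proof.
case: (eqVneq (even_parts s) [::]) => [e0|e0].
  by left; rewrite /mx e0 big_nil.
by right; move: (bigmax_mem e0); rewrite mem_filter => /andP[].
Qed.

Let even_mx : ~~ odd mx.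
Proof. by case: mxP => [[->]|[]]. Qed.

Let count_gt0 v : (0 < count_mem v s)%N = (v \in s).
Proof. by rewrite -has_count has_pred1. Qed.

(** Even parts above 2m have multiplicity 0, and 2m itself, if positive, has odd multiplicity and so
    occurs. *)
Lemma EObar_mult_max m : (m < N)%N ->
  mult_pred N.*2 (EObar_mult m) s -> m = mx./2.
Proof.
move=> mN /mult_predP H; suff -> : mx = m.*2 by rewrite doubleK.
apply/eqP; rewrite eqn_leq; apply/andP; split.
  apply/bigmax_leqP_seq => v; rewrite mem_filter => /andP[ov vs] _.
  have /andP[v0 vn] := part_bounds sn vs.
  have vK : (0 < v <= N.*2)%N by lia.
  rewrite leqNgt; apply/negP => vm; have := H v vK; move: vs.
  rewrite /EObar_mult (negbTE ov) ltnNge (ltnW vm) gtn_eqF //= -count_gt0.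
  by case: count.
case: m mN H => // m mN H; apply: le_mx; last by rewrite odd_double.
rewrite -count_gt0; have := H m.+1.*2; rewrite /EObar_mult odd_double ltnn eqxx.
by rewrite leq_double (ltnW mN) => /(_ isT); case: count.
Qed.

(** Parts are positive, so without even parts [v == mx] is false throughout and the two branches of
    the definition merge. *)
Let only_largestE : only_largest_even_odd s =
  all (fun v => odd (count_mem v s) == (v == mx)) s.
Proof.
rewrite /only_largest_even_odd -/mx; case: ifP => // /nilP e0.
apply: eq_in_all => v /(part_bounds sn)/andP[v0 _].
case: mxP => [[-> _]|[_ _]]; last by rewrite e0.
by rewrite (gtn_eqF v0) eqbF_neg.
Qed.

Lemma EObar_partE : EObar_part s = mult_pred N.*2 (EObar_mult mx./2) s.
Proof.
rewrite /EObar_mult /EObar_part only_largestE.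
have -> : mx./2.*2 = mx.
  by rewrite -[RHS]odd_double_half (negbTE even_mx).
have odd_neq v : odd v -> (v == mx) = false.
  by move=> ov; apply/eqP => vmx; move: even_mx; rewrite -vmx ov.
apply/andP/mult_predP => [[/allP bel /allP ol] v /andP[v0 vK] | H].
  (* An absent [v] has multiplicity 0, which is only forbidden at [v = mx]; but a positive [mx] is a
     part. *)
  case vs: (v \in s); last first.
    move/negbT/count_memPn: (vs) => ->; rewrite eqxx /= !if_same.
    case: ifP => // ov; case: ifP => // _; case: eqP => // vmx.
    case: mxP => [[mx0]|[]]; first by rewrite vmx mx0 in v0.
    by rewrite -vmx vs.
  have /eqP -> := ol v vs; case: ifP => ov.
    (* An odd part below [mx] would contradict [evens_below_odds], as [mx] is then an even part. *)
    case: ltnP => [vmx | _]; last by rewrite odd_neq.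
    case: mxP => [[mx0]|[mxs omx _]]; first by rewrite mx0 in vmx.
    have /bel/allP/(_ v) : mx \in even_parts s by rewrite mem_filter omx.
    by rewrite mem_filter ov vs => /(_ isT); rewrite ltnNge (ltnW vmx).
  have := le_mx vs (negbT ov); rewrite leq_eqVlt => /orP[/eqP -> | vmx].
    by rewrite ltnn eqxx.
  by rewrite vmx ltn_eqF.
have Hs v : v \in s -> (if odd v then (mx < v)%N && ~~ odd (count_mem v s)
    else odd (count_mem v s) == (v == mx)).
  move=> vs; have /andP[v0 vn] := part_bounds sn vs.
  have vK : (0 < v <= N.*2)%N by lia.
  move: (H v vK) (vs); rewrite -count_gt0 => Hv c0; move: Hv.
  case: ifP => ov.
    case: ltnP => [_ /eqP e|mv cv]; first by rewrite e in c0.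
    by rewrite ltn_neqAle eq_sym odd_neq // mv cv.
  have := le_mx vs (negbT ov); rewrite leq_eqVlt => /orP[/eqP -> | vmx].
    by rewrite ltnn eqxx => ->.
  by rewrite vmx ltn_eqF // => /negbTE ->.
split; apply/allP => v; last first.
  move=> vs; have := Hs v vs; case: ifP => // ov /andP[_ /negbTE ->].
  by rewrite odd_neq.
rewrite mem_filter => /andP[ov vs]; apply/allP => w.
rewrite mem_filter => /andP[ow ws]; have := Hs w ws; rewrite ow => /andP[+ _].
exact/leq_ltn_trans/le_mx.
Qed.

(** By [EObar_mult_max] only the term [m = mx./2] can be nonzero. *)
Lemma EObar_part_sum :
  EObar_part s = (\sum_(m < N) mult_pred N.*2 (EObar_mult m) s)%N :> nat.
Proof.
have mxN : (mx./2 < N)%N.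
  case: mxP => [[-> _]|[/(part_bounds sn)]]; lia.
rewrite (bigD1 (Ordinal mxN)) //= -EObar_partE big1 ?addn0 // => m.
case: (boolP (mult_pred _ _ _)) => // /(EObar_mult_max (ltn_ord m)) me.
by rewrite -val_eqE /= me eqxx.
Qed.

End EObarMult.

(** * Generating functions evaluated at a nilpotent element *)

Lemma big_ord_double (R : Type) (idx : R) (op : Monoid.law idx) n
    (F : nat -> R) :
  \big[op/idx]_(i < n.*2) F i = \big[op/idx]_(k < n) op (F k.*2) (F k.*2.+1).
Proof.
elim: n => [|n IH]; first by rewrite !big_ord0.
by rewrite doubleS !big_ord_recr /= IH Monoid.mulmA.
Qed.

Lemma geom_even (A : comNzRingType) N (a : A) : a ^+ N = 0 ->
  \sum_(j < N | ~~ odd j) a ^+ j = geom N (a ^+ 2).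
Proof.
(* Widening the range to 2N adds only vanishing powers and lets the indices be paired by parity. *)
move=> aN0; transitivity (\sum_(j < N.*2) if odd j then 0 else a ^+ j).
  rewrite (big_ord_widen_cond N.*2 (fun j => ~~ odd j) (fun j => a ^+ j));
    last by lia.
  rewrite big_mkcond; apply: eq_bigr => j _ /=.
  case: (odd j) => //=; case: ltnP => // /(expr_nilpotent_eq0 aN0) -> //.
rewrite (big_ord_double _ _ (fun j => if odd j then 0 else a ^+ j)).
apply: eq_bigr => k _.
by rewrite /= odd_double addr0 -mul2n exprM.
Qed.

Lemma geom_odd (A : comNzRingType) N (a : A) : a ^+ N = 0 ->
  \sum_(j < N | odd j) a ^+ j = a * geom N (a ^+ 2).
Proof.
move=> aN0; transitivity (\sum_(j < N.*2) if odd j then a ^+ j else 0).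
  rewrite (big_ord_widen_cond N.*2 odd (fun j => a ^+ j)); last by lia.
  rewrite big_mkcond; apply: eq_bigr => j _ /=.
  case: (odd j) => //=; case: ltnP => // /(expr_nilpotent_eq0 aN0) -> //.
rewrite (big_ord_double _ _ (fun j => if odd j then a ^+ j else 0)).
rewrite mulr_sumr; apply: eq_bigr => k _.
by rewrite /= odd_double add0r -exprM mul2n exprS.
Qed.

Section GeneratingFunctions.
Variables (A : comNzRingType) (N : nat) (x : A).
Hypotheses (xN0 : x ^+ N = 0) (N_gt1 : (1 < N)%N).

Let le_N_2N : (N <= N.*2)%N. Proof. by lia. Qed.

Let xvN0 v : (0 < v)%N -> x ^+ v ^+ N = 0.
Proof. exact: expr_nilpotentX. Qed.

Lemma p_generating :
  \sum_(n < N) (npart predT n)%:R * x ^+ n =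
  \prod_(k < N) (geom N (x ^+ k.*2.+1) * geom N (x ^+ k.*2.+2)).
Proof.
rewrite -(big_ord_double _ N (fun i => geom N (x ^+ i.+1))).
rewrite -(partition_generating (fun _ _ => true) xN0 le_N_2N).
apply: eq_bigr => n _; congr (_%:R * _); apply: npart_eq => s _.
by apply/esym/mult_predP.
Qed.

Lemma pod_generating :
  \sum_(n < N) (pod n)%:R * x ^+ n =
  \prod_(k < N) ((1 + x ^+ k.*2.+1) * geom N (x ^+ k.*2.+2)).
Proof.
transitivity (\prod_(i < N.*2)
    \sum_(j < N | odd i.+1 ==> (j <= 1)%N) x ^+ i.+1 ^+ j).
  rewrite -(partition_generating (fun v j => odd v ==> (j <= 1)%N) xN0 le_N_2N).
  apply: eq_bigr => n _; congr (_%:R * _); apply: npart_eq => s sn.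
  by apply: odd_parts_distinct_mult sn; have := ltn_ord n; lia.
rewrite (big_ord_double _ N
  (fun i => \sum_(j < N | odd i.+1 ==> (j <= 1)%N) x ^+ i.+1 ^+ j)).
apply: eq_bigr => k _; congr (_ * _) => /=; last by rewrite odd_double.
rewrite odd_double /=; move: (x ^+ _) => a; clear -N_gt1.
(* Both multiplicities 0 and 1 are in range because [1 < N]. *)
case: N N_gt1 => [|[|M]] // _.
by rewrite big_mkcond !big_ord_recl big1 //= addr0 expr0 expr1.
Qed.

Lemma EObar_generating :
  \sum_(n < N) (npart EObar_part n)%:R * x ^+ n =
  \sum_(m < N) \prod_(i < N.*2)
    \sum_(j < N | EObar_mult m i.+1 j) x ^+ i.+1 ^+ j.
Proof.
under [RHS]eq_bigr do rewrite -(partition_generating _ xN0 le_N_2N).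
rewrite exchange_big; apply: eq_bigr => n _ /=.
rewrite -mulr_suml -natr_sum; congr (_%:R * _); apply: npart_sum => s sn.
exact: EObar_part_sum (ltn_ord n) sn.
Qed.

Let y := x ^+ 2.

Let yN0 : y ^+ N = 0.
Proof. exact: xvN0. Qed.

(** The factor for the parts 2k+1 and 2k+2 is treated together with [1 - y ^+ k.*2.+1]. For k < m
    the odd part is absent and the even part gives [geom N (y ^+ k.*2.+2)]; for k >= m the even part
    is absent and the odd part's series cancels. The odd multiplicity of 2m leaves [y ^+ m]. *)
Lemma EObar_term m : (m < N)%N ->
  (\prod_(i < N.*2) \sum_(j < N | EObar_mult m i.+1 j) x ^+ i.+1 ^+ j) *
    \prod_(k < N) (1 - y ^+ k.*2.+1) =
  y ^+ m * \prod_(i < m) ((1 - y ^+ i.*2.+1) * geom N (y ^+ i.*2.+2)).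
Proof.
move=> mN.
rewrite (big_ord_double _ N
  (fun i => \sum_(j < N | EObar_mult m i.+1 j) x ^+ i.+1 ^+ j)) -big_split /=.
have sum0 (a : A) : \sum_(j < N | j == 0%N :> nat) a ^+ j = 1.
  by rewrite (big_pred1 (Ordinal (ltnW N_gt1))).
(* The power is placed at the index [k] with 2k+2 = 2m; for [m = 0] there is no such index and the
   power is 1. *)
have -> : y ^+ m = \prod_(k < N) (if k.+1 == m then y ^+ m else 1).
  rewrite -big_mkcond; case: m mN => [|m] mN; first by rewrite big_pred0.
  by rewrite (big_pred1 (Ordinal (ltnW mN))) // => k; rewrite eqSS.
rewrite (big_ord_widen N
  (fun i => (1 - y ^+ i.*2.+1) * geom N (y ^+ i.*2.+2)) (ltnW mN)).
rewrite [X in _ * X]big_mkcond -big_split; apply: eq_bigr => k _ /=.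
rewrite /EObar_mult /= odd_double /= !ltn_Sdouble -doubleS ltn_double.
have -> : \sum_(j < N | if (k < m)%N then j == 0%N :> nat else ~~ odd j)
    x ^+ k.*2.+1 ^+ j = (if (k < m)%N then 1 else geom N (y ^+ k.*2.+1)).
  by case: ltnP; rewrite ?sum0 // geom_even ?xvN0 // exprAC.
have -> : \sum_(j < N | if (k.+1 < m)%N then ~~ odd j
      else if k.+1.*2 == m.*2 then odd j else j == 0%N :> nat) x ^+ k.+1.*2 ^+ j
    = (if k.+1 == m then y ^+ m else 1) *
      (if (k < m)%N then geom N (y ^+ k.+1.*2) else 1).
  rewrite (inj_eq double_inj).
  case: (ltngtP k.+1 m) => [km|mk|<-].
  - by rewrite mul1r geom_even ?xvN0 // exprAC.
  - by rewrite sum0 mulr1.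
  - by rewrite geom_odd ?xvN0 // exprAC -mul2n exprM.
case: ltnP => _; first by rewrite mul1r -mulrA [geom _ _ * _]mulrC.
by rewrite !mulr1 mulrAC [geom _ _ * _]mulrC (geomK (expr_nilpotentX yN0 _)) ?mul1r.
Qed.

(** After [gauss_sum] and [EObar_term], what remains is a factorwise comparison: with a = x^(2k+1),
    (1 - a^2)/(1 - a) = 1 + a. *)
Lemma partition_identity :
  (\sum_(n < N) (npart predT n)%:R * x ^+ n) *
    (\sum_(j < N.*2) y ^+ 'C(j.+1, 2)) =
  (\sum_(n < N) (pod n)%:R * x ^+ n) *
    (\sum_(n < N) (npart EObar_part n)%:R * x ^+ n).
Proof.
rewrite -(gauss_sum yN0) -(eq_bigr _ (fun m _ => EObar_term (ltn_ord m))).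
rewrite -mulr_suml -EObar_generating mulrA mulrAC; congr (_ * _).
rewrite p_generating pod_generating -big_split; apply: eq_bigr => k _ /=.
have := geomK (xvN0 (ltn0Sn k.*2)); rewrite /y exprAC.
move: (x ^+ k.*2.+1) (geom N (x ^+ k.*2.+1)) (geom N (x ^+ k.*2.+2)) => a c b ac1.
transitivity ((1 - a) * c * (1 + a) * b); first by ring.
by rewrite ac1 mul1r.
Qed.

End GeneratingFunctions.

(** * Extraction of coefficients and the final identity *)

Lemma in_qpoly_Xn_coef (R : comNzRingType) N (u v : {poly R}) k :
  in_qpoly 'X^(N.+1) u = in_qpoly 'X^(N.+1) v -> (k <= N)%N -> u`_k = v`_k.
Proof.
move=> /(congr1 val); rewrite /= mk_monic_Xn /= => uv kN.
(* The quotient part is a multiple of X^(N+1), invisible at an index at most [N]. *)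
rewrite (Pdiv.RingMonic.rdivp_eq (monicXn R N.+1) u).
rewrite (Pdiv.RingMonic.rdivp_eq (monicXn R N.+1) v).
by rewrite !coefD !coefMXn ltnS kN !add0r uv.
Qed.

Lemma coef_sum_Xn (R : nzRingType) N (f : nat -> nat) k : (k < N)%N ->
  (\sum_(n < N) (f n)%:R * 'X^n : {poly R})`_k = (f k)%:R.
Proof.
move=> kN; have := coef_poly N (fun n => (f n)%:R : R) k; rewrite kN => <-.
rewrite poly_def; congr ((polyseq _)`_k); apply: eq_bigr => n _.
by rewrite -mul_polyC rmorph_nat.
Qed.

Lemma nat_of_int_subn (f : nat -> nat) (m n : nat) :
  (if n%:Z - m%:Z is Posz k then f k else 0%N) =
  (if (m <= n)%N then f (n - m)%N else 0%N).
Proof.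
case: leqP => mn; first by rewrite subzn.
have -> // : n%:Z - m%:Z = Negz (m - n).-1.
by rewrite NegzE prednK ?subn_gt0 // -subzn ?(ltnW mn) // opprB.
Qed.

Lemma fsum_nat (F : nat -> nat) M : (forall j, (M <= j)%N -> F j = 0%N) ->
  \sum_(j \in [set: nat]%classic) F j = \sum_(j < M) F j.
Proof.
move=> F0; rewrite fsbig_ord; apply/esym/fsbig_widen => // j [_ /= /negP].
by rewrite -leqNgt => /F0.
Qed.

Local Open Scope classical_set_scope.
Local Open Scope ring_scope.

Theorem theorem4p19 (n : nat) :
  \sum_(j \in [set: nat]) p (n%:Z - (2 * T j)%:Z) =
  \sum_(j \in [set: nat]) (pod j * EObar (n%:Z - j%:Z))%N.
Proof.
(* Working modulo X^(n+2) keeps the coefficient of X^n and ensures [1 < N] even for [n = 0]. *)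
pose N := n.+2; pose q : {poly %/ ('X^N : {poly int})} := in_qpoly _ 'X.
have TE j : T j = 'C(j.+1, 2) by rewrite bin2 /T addn1 mulnC divn2.
have qN0 : q ^+ N = 0.
  rewrite -rmorphXn; apply: val_inj => /=.
  by rewrite mk_monic_Xn Pdiv.RingMonic.rmodpp // monicXn.
(* The bound 2N is chosen to match the triangular sum in [partition_identity]. *)
rewrite (@fsum_nat _ N.*2) => [|j jN]; last by apply: p_triangular_eq0; lia.
rewrite (@fsum_nat _ n.+1) => [|j jN]; last by rewrite EObar_sub_eq0 ?muln0.
have := partition_identity qN0 isT.
pose gf f : {poly int} := \sum_(m < N) (f m)%:R * 'X^m.
have gfE f : \sum_(m < N) (f m)%:R * q ^+ m = in_qpoly _ (gf f).
  rewrite rmorph_sum; apply: eq_bigr => m _.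
  by rewrite rmorphM rmorph_nat rmorphXn.
have -> : \sum_(j < N.*2) (q ^+ 2) ^+ 'C(j.+1, 2) =
    in_qpoly _ (\sum_(j < N.*2) 'X^(2 * T j)).
  by rewrite rmorph_sum; apply: eq_bigr => j _; rewrite rmorphXn TE exprM.
rewrite !gfE -!rmorphM => /in_qpoly_Xn_coef/(_ (leqnSn n)).
(* On the left each X^(2 T_j) shifts the coefficients of the series of [p]; on the right stands the
   Cauchy product. *)
rewrite mulr_sumr coef_sum coefM => H.
apply/eqP; rewrite -(Num.Theory.eqr_nat int) !natr_sum; apply/eqP.
transitivity (\sum_(j < N.*2) (gf (npart predT) * 'X^(2 * T j))`_n).
  apply: eq_bigr => j _; rewrite /p nat_of_int_subn coefMXn ltnNge.
  case: leqP => //= _; rewrite coef_sum_Xn // /N; lia.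
rewrite {}H; apply: eq_bigr => j _.
rewrite natrM /EObar nat_of_int_subn -ltnS ltn_ord !coef_sum_Xn //;
  have := ltn_ord j; rewrite /N; lia.
Qed.
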